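(* Let $r\le n$, $q\le n^2$, let $\mathcal{A}:\mathbb{R}^{n\times n}\to\mathbb{R}^q$ be a linear map, $\bm{b}\in\mathbb{R}^q$, $\lambda\ge0$, and let $\Psi,\Phi:\mathbb{R}^{n\times r}\to\mathbb{R}\cup\{+\infty\}$ be proper closed functions. Suppose that $\mathcal{A}\mathcal{A}^*=\mathcal{I}_q$ and that $\alpha,\beta\in\mathbb{R}$ are chosen such that $\frac1\alpha+\frac1\beta=1$. Then the following statements hold. (i) If $(\widetilde X,\widetilde Y,\widetilde Z)$ is a stationary point of $\Theta_{\alpha,\beta,\lambda}$, then $(\widetilde X,\widetilde Y)$ is a stationary point of $\mathcal{F}_\lambda$. (ii) If $(\widetilde X,\widetilde Y)$ is a stationary point of $\mathcal{F}_\lambda$, then $(\widetilde X,\widetilde Y,\widetilde Z)$ is a stationary point of $\Theta_{\alpha,\beta,\lambda}$, where $$\widetilde Z=\Big(\mathcal{I}-\tfrac{\beta}{\alpha+\beta}\mathcal{A}^*\mathcal{A}\Big)(\widetilde X\widetilde Y^\top)+\tfrac{\beta}{\alpha+\beta}\mathcal{A}^*(\bm{b}).$$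
   Context: For $X,Y\in\mathbb{R}^{n\times r}$ and $Z\in\mathbb{R}^{n\times n}$, $$\mathcal{F}_\lambda(X,Y):=\Psi(X)+\Phi(Y)+\tfrac12\|\mathcal{A}(XY^\top)-\bm{b}\|^2+\tfrac{\lambda}{2}\|X-Y\|_F^2,$$ $$\Theta_{\alpha,\beta,\lambda}(X,Y,Z):=\Psi(X)+\Phi(Y)+\tfrac{\alpha}{2}\|XY^\top-Z\|_F^2+\tfrac{\beta}{2}\|\mathcal{A}(Z)-\bm{b}\|^2+\tfrac{\lambda}{2}\|X-Y\|_F^2 .$$ $\|\cdot\|$ is the Euclidean norm, $\|\cdot\|_F$ the Frobenius norm; $\mathcal{A}^*$ is the adjoint of $\mathcal{A}$; $\mathcal{I}_q$ and $\mathcal{I}$ are the identity maps on $\mathbb{R}^q$ and $\mathbb{R}^{n\times n}$. A function is closed if it is lower semicontinuous. The limiting subdifferential of a proper closed $h$ at $X\in\mathrm{dom}\,h$ is $\partial h(X)=\{D:\exists X^k\to X,\ h(X^k)\to h(X),\ D^k\to D,\ D^k\in\widehat\partial h(X^k)\ \forall k\}$, where the Fréchet subdifferential $\widehat\partial h(\widetilde Y)$ is the set of $D$ with $\liminf_{Y\to\widetilde Y,\,Y\ne\widetilde Y}\frac{h(Y)-h(\widetilde Y)-\langle D,Y-\widetilde Y\rangle}{\|Y-\widetilde Y\|_F}\ge 0$. A stationary point of $h$ is a point $\widetilde X$ with $0\in\partial h(\widetilde X)$. *)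

(* Defs.v *)
From HB Require Import structures.
From mathcomp Require Import all_boot all_order all_algebra.
From mathcomp Require Import all_classical all_reals all_analysis.

Set Implicit Arguments.
Unset Strict Implicit.
Unset Printing Implicit Defensive.

Import Order.TTheory GRing.Theory Num.Theory.
Import numFieldNormedType.Exports.

Local Open Scope classical_set_scope.
Local Open Scope ring_scope.

(* For column vectors ([c = 1]) this is the Euclidean inner product. *)
Definition frob_ip (R : realType) (m c : nat) (A B : 'M[R]_(m, c)) : R :=
  \tr (A^T *m B).

Definition prod_ip (R : realType) (U V : Type) (ipU : U -> U -> R)
    (ipV : V -> V -> R) (u v : U * V) : R :=
  ipU u.1 v.1 + ipV u.2 v.2.

Definition ip_norm (R : realType) (V : Type) (ip : V -> V -> R) (v : V) : R :=
  Num.sqrt (ip v v).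

Definition frob_norm (R : realType) (m c : nat) (A : 'M[R]_(m, c)) : R :=
  ip_norm (@frob_ip R m c) A.

(* Entry [(i, j)] is forced by testing <A X, y> = <X, A^* y> on the matrix
   units; see [adjointP]. *)
Definition adjoint (R : realType) (n q : nat)
    (A : {linear 'M[R]_n -> 'cV[R]_q}) (y : 'cV[R]_q) : 'M[R]_n :=
  \matrix_(i, j) frob_ip (A (delta_mx i j)) y.

Lemma adjointP (R : realType) (n q : nat)
    (A : {linear 'M[R]_n -> 'cV[R]_q}) (X : 'M[R]_n) (y : 'cV[R]_q) :
  frob_ip (A X) y = frob_ip X (adjoint A y).
Proof.
have frobE m c (B C : 'M[R]_(m, c)) :
    frob_ip B C = \sum_i \sum_j B i j * C i j.
  rewrite /frob_ip /mxtrace exchange_big; apply: eq_bigr => j _.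
  by rewrite !mxE; apply: eq_bigr => i _; rewrite !mxE.
rewrite frobE [X in A X]matrix_sum_delta raddf_sum [RHS]frobE.
under eq_bigr => k _ do under eq_bigr => l _ do
  rewrite summxE big_distrl.
under eq_bigr => k _ do rewrite exchange_big.
rewrite exchange_big; apply: eq_bigr => i _ /=.
under eq_bigr => k _ do under eq_bigr => l _ do
  rewrite raddf_sum summxE big_distrl.
under eq_bigr => k _ do rewrite exchange_big.
rewrite exchange_big; apply: eq_bigr => j _ /=.
rewrite mxE frobE big_distrr; apply: eq_bigr => k _ /=.
rewrite big_distrr; apply: eq_bigr => l _ /=.
by rewrite linearZ mxE mulrA.
Qed.

Section Subdifferential.
(* The topology of the finite-dimensional space [V] is the library's; inner
   products and norms in the definitions below are those of [ip], since the
   library's norms on matrices and on pairs are maximum norms. *)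
Variables (R : realType) (V : normedModType R) (ip : V -> V -> R).
Implicit Types (h : V -> \bar R) (x D : V).

Definition effective_domain h : set V := [set x | (h x < +oo)%E].

Definition proper_function h : Prop := (forall x, (-oo < h x)%E) /\ effective_domain h !=set0.

(* The domain condition is needed: in [\bar R], [+oo - +oo = -oo], and on the
   zero space the liminf is over an improper filter, hence is [+oo]. *)
Definition frechet_subdiff h x : set V :=
  [set D | effective_domain h x /\
    (0 <= limf_einf
       (fun y => (h y - h x - (ip D (y - x))%:E)
                 * ((ip_norm ip (y - x))^-1)%:E) (x^'))%E].

Definition limiting_subdiff h x : set V :=
  [set D | effective_domain h x /\
    exists x_ D_ : nat -> V,
      [/\ x_ @ \oo --> x,
          (h \o x_) @ \oo --> h x,
          D_ @ \oo --> D &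
          forall k, frechet_subdiff h (x_ k) (D_ k)]].

Definition stationary_point h x : Prop := limiting_subdiff h x 0.

End Subdifferential.

Definition ip2 (R : realType) (n r : nat) :=
  prod_ip (@frob_ip R n r) (@frob_ip R n r).

Definition ip3 (R : realType) (n r : nat) :=
  prod_ip (@ip2 R n r) (@frob_ip R n n).

Section Objectives.
Variables (R : realType) (n r q : nat).
Variables (A : {linear 'M[R]_n -> 'cV[R]_q}) (b : 'cV[R]_q).
Variables (Psi Phi : 'M[R]_(n, r) -> \bar R).

Definition F_obj (lambda : R) (w : 'M[R]_(n, r) * 'M[R]_(n, r)) : \bar R :=
  let: (X, Y) := w in
  (Psi X + Phi Y
   + (2^-1 * frob_norm (A (X *m Y^T) - b) ^+ 2)%:E
   + (lambda / 2 * frob_norm (X - Y) ^+ 2)%:E)%E.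

Definition Theta_obj (alpha beta lambda : R)
    (w : 'M[R]_(n, r) * 'M[R]_(n, r) * 'M[R]_n) : \bar R :=
  let: (X, Y, Z) := w in
  (Psi X + Phi Y
   + (alpha / 2 * frob_norm (X *m Y^T - Z) ^+ 2)%:E
   + (beta / 2 * frob_norm (A Z - b) ^+ 2)%:E
   + (lambda / 2 * frob_norm (X - Y) ^+ 2)%:E)%E.

End Objectives.

(* Main.v *)
(** Since [1/alpha + 1/beta = 1] and [A A^* = I], completing the square in [Z]
    gives [Theta(X,Y,Z) = F(X,Y) + Q(Z - G(X,Y))], where
    [G(X,Y) = (I - c A^* A)(X Y^T) + c A^* b], [c = beta/(alpha+beta)], and
    [Q(W) = alpha/2 |W|^2 + beta/2 |A W|^2] is a (possibly indefinite)
    nondegenerate quadratic form.  As [Q] is of second order and [G] is smooth,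
    a Frechet subgradient [d] of [F] at [x] lifts to the subgradient [(d, 0)] of
    [Theta] at [(x, G x)].  Conversely, if [(d, e)] is a Frechet subgradient of
    [Theta] at [(x, Z)], the [Z]-direction forces [e = grad Q(W)] with
    [W = Z - G x], and restricting to the curve [u |-> (u, G u + W)] shows that
    [d + DG(x)^* e] is a subgradient of [F] at [x].  Along a sequence with
    [e -> 0] nondegeneracy gives [W -> 0], hence the values of [F] converge. *)
Require Import Defs.
From HB Require Import structures.
From mathcomp Require Import all_boot all_order all_algebra.
From mathcomp Require Import all_classical all_reals all_analysis.
From mathcomp Require Import ring lra.

Set Implicit Arguments.
Unset Strict Implicit.
Unset Printing Implicit Defensive.

Import Order.TTheory GRing.Theory Num.Theory.
Import numFieldNormedType.Exports.

Local Open Scope classical_set_scope.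
Local Open Scope ring_scope.

(** * Frobenius inner product and norm *)

Section Frobenius.
Context {R : realType} {m c : nat}.
Implicit Types (A B C : 'M[R]_(m, c)) (a : R).

Lemma frob_ipE A B : frob_ip A B = \sum_i \sum_j A i j * B i j.
Proof.
rewrite /frob_ip /mxtrace exchange_big; apply: eq_bigr => j _.
by rewrite !mxE; apply: eq_bigr => i _; rewrite !mxE.
Qed.

Lemma frob_ipC A B : frob_ip A B = frob_ip B A.
Proof. by rewrite /frob_ip -mxtrace_tr trmx_mul trmxK. Qed.

Lemma frob_ipDr A B C : frob_ip A (B + C) = frob_ip A B + frob_ip A C.
Proof. by rewrite /frob_ip mulmxDr mxtraceD. Qed.

Lemma frob_ipZr a A B : frob_ip A (a *: B) = a * frob_ip A B.
Proof. by rewrite /frob_ip -scalemxAr mxtraceZ. Qed.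

Lemma frob_ipNr A B : frob_ip A (- B) = - frob_ip A B.
Proof. by rewrite -scaleN1r frob_ipZr mulN1r. Qed.

Lemma frob_ipBr A B C : frob_ip A (B - C) = frob_ip A B - frob_ip A C.
Proof. by rewrite frob_ipDr frob_ipNr. Qed.

Lemma frob_ipDl A B C : frob_ip (A + B) C = frob_ip A C + frob_ip B C.
Proof. by rewrite frob_ipC frob_ipDr !(frob_ipC C). Qed.

Lemma frob_ipZl a A B : frob_ip (a *: A) B = a * frob_ip A B.
Proof. by rewrite frob_ipC frob_ipZr frob_ipC. Qed.

Lemma frob_ipNl A B : frob_ip (- A) B = - frob_ip A B.
Proof. by rewrite frob_ipC frob_ipNr frob_ipC. Qed.

Lemma frob_ipBl A B C : frob_ip (A - B) C = frob_ip A C - frob_ip B C.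
Proof. by rewrite frob_ipDl frob_ipNl. Qed.

Lemma frob_ip0r A : frob_ip A 0 = 0.
Proof. by rewrite /frob_ip mulmx0 mxtrace0. Qed.

Lemma frob_ip0l A : frob_ip 0 A = 0.
Proof. by rewrite frob_ipC frob_ip0r. Qed.

Lemma frob_ip_ge0 A : 0 <= frob_ip A A.
Proof.
by rewrite frob_ipE; do 2!apply: sumr_ge0 => ? _; rewrite -expr2 sqr_ge0.
Qed.

Lemma sqr_frob_norm A : frob_norm A ^+ 2 = frob_ip A A.
Proof. by rewrite /frob_norm /ip_norm sqr_sqrtr // frob_ip_ge0. Qed.

Lemma frob_norm_ge0 A : 0 <= frob_norm A.
Proof. exact: sqrtr_ge0. Qed.

Lemma frob_norm0 : frob_norm (0 : 'M[R]_(m, c)) = 0.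
Proof. by rewrite /frob_norm /ip_norm frob_ip0r sqrtr0. Qed.

Lemma frob_norm_eq0 A : frob_norm A = 0 -> A = 0.
Proof.
move=> A0; have : frob_ip A A = 0 by rewrite -sqr_frob_norm A0 expr0n.
rewrite frob_ipE => /eqP; rewrite psumr_eq0; last first.
  by move=> i _; apply: sumr_ge0 => j _; rewrite -expr2 sqr_ge0.
move=> /allP s0; apply/matrixP => i j; rewrite mxE.
have := s0 i; rewrite mem_index_enum => /(_ isT) /=.
rewrite psumr_eq0 => [|k _]; last by rewrite -expr2 sqr_ge0.
move=> /allP /(_ j); rewrite mem_index_enum => /(_ isT) /=.
by rewrite mulf_eq0 orbb => /eqP.
Qed.

Lemma frob_norm_gt0 A : A != 0 -> 0 < frob_norm A.
Proof.
move=> A0; rewrite lt_neqAle frob_norm_ge0 andbT eq_sym.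
by apply: contra A0 => /eqP/frob_norm_eq0/eqP.
Qed.

Lemma frob_normZ a A : frob_norm (a *: A) = `|a| * frob_norm A.
Proof.
rewrite /frob_norm /ip_norm frob_ipZl frob_ipZr mulrA -expr2.
by rewrite sqrtrM ?sqr_ge0 // sqrtr_sqr.
Qed.

Lemma frob_normN A : frob_norm (- A) = frob_norm A.
Proof. by rewrite -scaleN1r frob_normZ normrN1 mul1r. Qed.

(** Cauchy-Schwarz: the squared norm of [<B,B> A - <A,B> B] equals [<B,B>] times the difference of
    the two sides, and [<B,B>] can be divided out unless [B = 0]. *)
Lemma sqr_frob_ip_le A B : frob_ip A B ^+ 2 <= frob_ip A A * frob_ip B B.
Proof.
have [B0|Bn0] := eqVneq (frob_ip B B) 0.
  have -> : B = 0.
    by apply: frob_norm_eq0; rewrite /frob_norm /ip_norm B0 sqrtr0.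
  by rewrite !frob_ip0r expr0n mulr0.
have Bgt0 : 0 < frob_ip B B by rewrite lt_neqAle eq_sym Bn0 frob_ip_ge0.
have := frob_ip_ge0 (frob_ip B B *: A - frob_ip A B *: B).
rewrite !(frob_ipBl, frob_ipBr, frob_ipZl, frob_ipZr) (frob_ipC B A).
set a := frob_ip A A; set b := frob_ip B B; set d := frob_ip A B => H.
by rewrite -subr_ge0 -(pmulr_rge0 _ Bgt0) -/b; nra.
Qed.

Lemma frob_ip_le A B : `|frob_ip A B| <= frob_norm A * frob_norm B.
Proof.
rewrite -ler_sqr ?nnegrE ?mulr_ge0 ?frob_norm_ge0 //.
by rewrite real_normK ?num_real // exprMn !sqr_frob_norm sqr_frob_ip_le.
Qed.

Lemma ler_frob_normD A B : frob_norm (A + B) <= frob_norm A + frob_norm B.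
Proof.
have := frob_ip_le A B; rewrite ler_norml => /andP[_ AB].
rewrite -ler_sqr ?nnegrE ?addr_ge0 ?frob_norm_ge0 // sqrrD !sqr_frob_norm.
by rewrite frob_ipDl !frob_ipDr (frob_ipC B A); lra.
Qed.

Lemma ler_frob_normB A B : frob_norm (A - B) <= frob_norm A + frob_norm B.
Proof. by rewrite -(frob_normN B) ler_frob_normD. Qed.

End Frobenius.

(** Entry [(i, j)] of [A *m B^T] is the inner product of row [i] of [A] with row [j] of [B].
    Cauchy-Schwarz bounds its square, and the bounds sum to the product of the squared norms. *)
Lemma frob_norm_mulmx_trmx (R : realType) (m p c : nat)
    (A : 'M[R]_(m, c)) (B : 'M[R]_(p, c)) :
  frob_norm (A *m B^T) <= frob_norm A * frob_norm B.
Proof.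
have rows k (C : 'M[R]_(k, c)) :
    frob_ip C C = \sum_i frob_ip (row i C) (row i C).
  rewrite frob_ipE; apply: eq_bigr => i _; rewrite frob_ipE big_ord1.
  by apply: eq_bigr => j _; rewrite !mxE.
rewrite -ler_sqr ?nnegrE ?mulr_ge0 ?frob_norm_ge0 // exprMn !sqr_frob_norm.
rewrite frob_ipE (rows _ A) (rows _ B) big_distrl; apply: ler_sum => i _ /=.
rewrite big_distrr; apply: ler_sum => j _ /=; rewrite -expr2.
suff -> : (A *m B^T) i j = frob_ip (row i A) (row j B) by exact: sqr_frob_ip_le.
by rewrite mxE frob_ipE big_ord1; apply: eq_bigr => k _; rewrite !mxE.
Qed.

(** * Entrywise convergence and continuity of matrix operations *)

Lemma cvg_mx (R : realType) (m c : nat) (T : Type) (F : set_system T)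
    {FF : Filter F} (f : T -> 'M[R]_(m, c)) (M : 'M[R]_(m, c)) :
  (forall i j, f x i j @[x --> F] --> M i j) -> f @ F --> M.
Proof.
move=> fM S [P MP PS].
have FP : \forall x \near F, forall i j, P i j (f x i j).
  apply: (@filter_forall _ _ (fun i x => forall j, P i j (f x i j))) => i.
  apply: (@filter_forall _ _ (fun j x => P i j (f x i j))) => j.
  exact: (fM i j _ (MP i j)).
by apply: filterS FP => x xP; exact: PS.
Qed.

Lemma cvg_coord (R : realType) (m c : nat) (T : Type) (F : set_system T)
    {FF : Filter F} (f : T -> 'M[R]_(m, c)) (M : 'M[R]_(m, c)) i j :
  f @ F --> M -> f x i j @[x --> F] --> M i j.
Proof.
by move=> fM; exact: (cvg_comp _ _ fM (@coord_continuous _ _ _ i j M)).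
Qed.

Lemma cvg_trmx (R : realType) (m c : nat) (T : Type) (F : set_system T)
    {FF : Filter F} (f : T -> 'M[R]_(m, c)) (M : 'M[R]_(m, c)) :
  f @ F --> M -> (f x)^T @[x --> F] --> M^T.
Proof.
move=> fM; apply: cvg_mx => i j; rewrite mxE.
under eq_fun do rewrite mxE.
exact: cvg_coord.
Qed.

Lemma cvg_mulmx (R : realType) (m p c : nat) (T : Type) (F : set_system T)
    {FF : Filter F} (f : T -> 'M[R]_(m, p)) (g : T -> 'M[R]_(p, c))
    (M : 'M[R]_(m, p)) (N : 'M[R]_(p, c)) :
  f @ F --> M -> g @ F --> N -> f x *m g x @[x --> F] --> M *m N.
Proof.
move=> fM gN; apply: cvg_mx => i j; rewrite mxE.
under eq_fun do rewrite mxE.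
apply: (cvg_big add_continuous) => k _; apply: cvgM; exact: cvg_coord.
Qed.

(** Expanding the argument in matrix units makes each entry of the image a fixed finite linear
    combination of the entries of the argument. *)
Lemma linear_mx_continuous (R : realType) (m c p d : nat)
    (f : {linear 'M[R]_(m, c) -> 'M[R]_(p, d)}) : continuous f.
Proof.
move=> M; apply: (@cvg_mx _ _ _ _ _ (nbhs_filter M)) => i j.
have fE (N : 'M[R]_(m, c)) :
    f N i j = \sum_k \sum_l N k l * f (delta_mx k l) i j.
  rewrite [N in LHS]matrix_sum_delta raddf_sum summxE; apply: eq_bigr => k _.
  by rewrite raddf_sum summxE; apply: eq_bigr => l _ /=; rewrite linearZ mxE.
rewrite fE; under eq_fun do rewrite fE.
apply: (cvg_big add_continuous) => k _; apply: (cvg_big add_continuous) => l _.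
by apply: cvgM; [exact: coord_continuous|exact: cvg_cst].
Qed.

Lemma cvg_frob_norm (R : realType) (m c : nat) (T : Type) (F : set_system T)
    {FF : Filter F} (f : T -> 'M[R]_(m, c)) (M : 'M[R]_(m, c)) :
  f @ F --> M -> frob_norm (f x) @[x --> F] --> frob_norm M.
Proof.
move=> fM; have ipM : frob_ip (f x) (f x) @[x --> F] --> frob_ip M M.
  rewrite frob_ipE; under eq_fun do rewrite frob_ipE.
  do 2!(apply: (cvg_big add_continuous) => ? _).
  by apply: cvgM; exact: cvg_coord.
exact: (cvg_comp _ _ ipM (@sqrt_continuous R _)).
Qed.

(** * The adjoint of a map with [A A^* = I] *)

Section Adjoint.
Context {R : realType} {n q : nat} (A : {linear 'M[R]_n -> 'cV[R]_q}).

Lemma adjoint_is_linear : linear (adjoint A).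
Proof.
by move=> a y z; apply/matrixP => i j; rewrite !mxE frob_ipDr frob_ipZr.
Qed.

HB.instance Definition _ :=
  GRing.isLinear.Build R 'cV[R]_q 'M[R]_n *:%R (adjoint A) adjoint_is_linear.

Hypothesis AAadj : forall y : 'cV[R]_q, A (adjoint A y) = y.

(** [A^* A] is an orthogonal projection, so [<X, A^* A X> = |A^* A X|^2]. Cauchy-Schwarz and
    division by [|A^* A X|] give the bound. *)
Lemma frob_norm_adjoint_comp (X : 'M[R]_n) :
  frob_norm (adjoint A (A X)) <= frob_norm X.
Proof.
have := frob_ip_le X (adjoint A (A X)).
have -> : frob_ip X (adjoint A (A X)) = frob_norm (adjoint A (A X)) ^+ 2.
  by rewrite sqr_frob_norm -!adjointP AAadj.
rewrite ger0_norm ?sqr_ge0 // expr2.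
have [->|n0] := eqVneq (frob_norm (adjoint A (A X))) 0.
  by rewrite frob_norm_ge0.
by rewrite ler_pM2r // lt_neqAle eq_sym n0 frob_norm_ge0.
Qed.

End Adjoint.

(** * Epsilon form of the Frechet subdifferential *)

Section FrechetSubdifferential.
Context {R : realType} {V : normedModType R} (ip : V -> V -> R).
Hypothesis ip0r : forall v, ip v 0 = 0.
Hypothesis ip_norm_gt0 : forall v, v != 0 -> 0 < ip_norm ip v.

(** Clearing the positive denominator turns the liminf condition into a local minorant of [h] up to
    [e] times the distance. The point [y = x] may then be included, where the inequality is an
    equality. *)
Lemma frechet_subdiffP (h : V -> \bar R) (x D : V) :
  (forall y, (-oo < h y)%E) ->
  frechet_subdiff ip h x D <->
  effective_domain h x /\ forall e, 0 < e -> \forall y \near x,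
    (h x + (ip D (y - x) - e * ip_norm ip (y - x))%:E <= h y)%E.
Proof.
move=> hNy.
have N0 : ip_norm ip 0 = 0 by rewrite /ip_norm ip0r sqrtr0.
have quot (r e : R) y : h x = r%:E -> y != x ->
    ((- e)%:E <= (h y - h x - (ip D (y - x))%:E)
                 * ((ip_norm ip (y - x))^-1)%:E)%E =
    (h x + (ip D (y - x) - e * ip_norm ip (y - x))%:E <= h y)%E.
  move=> hx yx.
  have Ngt0 : 0 < ip_norm ip (y - x) by apply: ip_norm_gt0; rewrite subr_eq0.
  rewrite hx; have := hNy y; case: (h y) => [s| |] //= _; last first.
    by rewrite gt0_mulye ?lte_fin ?invr_gt0 // !leey.
  by rewrite -EFinM !lee_fin ler_pdivlMr //; apply/idP/idP; lra.
have fin : effective_domain h x -> exists r, h x = r%:E.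
  move: (hNy x); rewrite /effective_domain /=.
  by case: (h x) => // r; exists r.
split=> -[xdom H]; split => //; have [r hx] := fin xdom.
- move=> e e0.
  (* The liminf is a supremum of infima over punctured neighbourhoods, so a nonnegative liminf
     provides one such set with infimum above [- e]. *)
  have /ereal_sup_gt[_ [S xS <-] eS] : ((- e)%:E < ereal_sup
      [set ereal_inf ((fun y => (h y - h x - (ip D (y - x))%:E)
                 * ((ip_norm ip (y - x))^-1)%:E) @` S) | S in x^'])%E.
    rewrite -limf_einfE; apply: lt_le_trans H.
    by rewrite lte_fin oppr_lt0.
  have : \forall y \near x, y != x -> S y by exact: xS.
  apply: filterS => y Sy.
  have [->|yx] := eqVneq y x.
    by rewrite subrr ip0r N0 mulr0 subr0 adde0.
  rewrite -(quot r) //; apply: (le_trans (ltW eS)).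
  by apply: ereal_inf_lbound; exists y => //; exact: Sy.
- rewrite limf_einfE; apply/lee_subgt0Pr => e e0; rewrite sub0e -EFinN.
  pose S := [set y | y != x /\
    (h x + (ip D (y - x) - e * ip_norm ip (y - x))%:E <= h y)%E].
  apply: (@le_trans _ _ (ereal_inf ((fun y => (h y - h x - (ip D (y - x))%:E)
                 * ((ip_norm ip (y - x))^-1)%:E)%E @` S))); last first.
    apply: ereal_sup_ubound; exists S => //.
    by have := H e e0; apply: filterS => y Hy yx; split.
  apply/ereal_infP => _ [y [yx Hy] <-]; by rewrite (quot r).
Qed.

End FrechetSubdifferential.

Lemma near_frob_norm_le (R : realType) (m c : nat) (M : 'M[R]_(m, c)) (e : R) :
  0 < e -> \forall Z \near M, frob_norm (Z - M) <= e.
Proof.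
move=> e0.
have : frob_norm (Z - M) @[Z --> M] --> (0 : R).
  rewrite -(@frob_norm0 R m c) -(subrr M).
  by apply: (@cvg_frob_norm _ _ _ _ _ (nbhs_filter M));
    apply: cvgB; [exact: cvg_id|exact: cvg_cst].
move=> /cvgr0Pnorm_le /(_ _ e0); apply: filterS => Z.
by rewrite ger0_norm ?frob_norm_ge0.
Qed.

(** * The Euclidean norm on a product space *)

Section ProductNorm.
Context {R : realType} {V : normedModType R} (ip : V -> V -> R) {m c : nat}.
Hypothesis ip0r : forall v, ip v 0 = 0.
Hypothesis ip_norm_gt0 : forall v, v != 0 -> 0 < ip_norm ip v.
Let ipM := prod_ip ip (@frob_ip R m c).

Lemma ip_norm0 : ip_norm ip 0 = 0.
Proof. by rewrite /ip_norm ip0r sqrtr0. Qed.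

Lemma ip_norm_ge0 v : 0 <= ip_norm ip v.
Proof. exact: sqrtr_ge0. Qed.

Lemma sqr_ip_norm_prod w :
  ip_norm ipM w ^+ 2 = ip_norm ip w.1 ^+ 2 + frob_norm w.2 ^+ 2.
Proof.
have ip_ge0 v : 0 <= ip v v.
  have [->|v0] := eqVneq v 0; first by rewrite ip0r.
  (* [Num.sqrt] is zero on negative reals, so a positive norm forces [ip v v] to be positive. *)
  by move: (ip_norm_gt0 v0); rewrite sqrtr_gt0 => /ltW.
by rewrite sqr_frob_norm !sqr_sqrtr // addr_ge0 // frob_ip_ge0.
Qed.

Lemma le_ip_norm_prod1 w : ip_norm ip w.1 <= ip_norm ipM w.
Proof.
by rewrite -ler_sqr ?nnegrE ?sqrtr_ge0 // sqr_ip_norm_prod lerDl sqr_ge0.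
Qed.

Lemma le_ip_norm_prod2 w : frob_norm w.2 <= ip_norm ipM w.
Proof.
by rewrite -ler_sqr ?nnegrE ?sqrtr_ge0 // sqr_ip_norm_prod lerDr sqr_ge0.
Qed.

Lemma ip_norm_prod_le w : ip_norm ipM w <= ip_norm ip w.1 + frob_norm w.2.
Proof.
rewrite -ler_sqr ?nnegrE ?addr_ge0 ?sqrtr_ge0 // sqr_ip_norm_prod sqrrD.
have := mulr_ge0 (ip_norm_ge0 w.1) (frob_norm_ge0 w.2); lra.
Qed.

Lemma ip_norm_prod_gt0 w : w != 0 -> 0 < ip_norm ipM w.
Proof.
move=> w0; rewrite lt_neqAle sqrtr_ge0 andbT eq_sym.
apply: contra w0 => /eqP w0.
have := le_ip_norm_prod1 w; have := le_ip_norm_prod2 w; rewrite w0 => w2 w1.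
have w20 : w.2 = 0.
  by apply: frob_norm_eq0; apply/eqP; rewrite eq_le w2 frob_norm_ge0.
have w10 : w.1 = 0.
  by apply/eqP/negPn/negP => /ip_norm_gt0; rewrite ltNge w1.
by apply/eqP; case: w w10 w20 {w0 w1 w2} => a b /= -> ->.
Qed.

Lemma ip_prod0r w : ipM w 0 = 0.
Proof. by rewrite /ipM /prod_ip /= ip0r frob_ip0r addr0. Qed.

End ProductNorm.

(** * Subgradients of [F u + Q (Z - G u)] for a second-order [Q] *)

Section Lift.
Context {R : realType} {V : normedModType R} (ip : V -> V -> R) {n : nat}.
Context (F : V -> \bar R) (G : V -> 'M[R]_n) (Q : 'M[R]_n -> R) (K : R).
Hypothesis ip0r : forall v, ip v 0 = 0.
Hypothesis ip_norm_gt0 : forall v, v != 0 -> 0 < ip_norm ip v.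
Hypothesis FNy : forall v, (-oo < F v)%E.
Hypothesis K_ge0 : 0 <= K.
Hypothesis Q_le : forall W, `|Q W| <= K * frob_norm W ^+ 2.

Let N := ip_norm ip.
Let ipG := prod_ip ip (@frob_ip R n n).
Let T (w : V * 'M[R]_n) : \bar R := (F w.1 + (Q (w.2 - G w.1))%:E)%E.

Let TNy w : (-oo < T w)%E.
Proof.
by rewrite /T; case: (F w.1) (FNy w.1) => [s| |] //= _; rewrite ltNyr.
Qed.

Let frechetTP (w D : V * 'M[R]_n) :=
  frechet_subdiffP (ip_prod0r ip0r) (ip_norm_prod_gt0 ip0r ip_norm_gt0) w D TNy.

(** Since [Z - G u] is at most [1 + L] times the distance to [(x, G x)], the penalty is quadratic in
    that distance. It costs half of the tolerance [e], and the inequality for [F] the other half. *)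
Lemma frechet_subdiff_lift (x d : V) (L : R) : 0 <= L ->
  (forall e, 0 < e -> \forall u \near x, N (u - x) <= e) ->
  (\forall u \near x, frob_norm (G u - G x) <= L * N (u - x)) ->
  frechet_subdiff ip F x d -> frechet_subdiff ipG T (x, G x) (d, 0).
Proof.
move=> L0 Ncont GL /(frechet_subdiffP ip0r ip_norm_gt0 _ _ FNy)[xdom Fx].
apply/frechetTP.
have Q0 : Q 0 = 0.
  by apply/eqP; have := Q_le 0; rewrite frob_norm0 expr0n mulr0 normr_le0.
split; first by rewrite /effective_domain /T /= subrr Q0 adde0.
move=> e e0.
have e2 : 0 < e / 2 by lra.
pose M := K * (1 + L) ^+ 2.
have M0 : 0 <= M by rewrite mulr_ge0 ?sqr_ge0.
(* The distance [nu] in the product will be at most [2 * r], so that [M * nu ^ 2 <= 2 * M * r * nu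
   <= e / 2 * nu]. The [+ 1] covers [M = 0]. *)
pose r := e / (4 * (M + 1)).
have r0 : 0 < r by rewrite divr_gt0 //; lra.
have rM : 2 * M * r <= e / 2.
  rewrite /r mulrA ler_pdivrMr; last by lra.
  by nra.
have near_fst (P : set V) : nbhs x P ->
    \forall y \near (x, G x), P (y : V * 'M[R]_n).1.
  by move=> xP; exact: (@cvg_fst _ _ (nbhs x) (nbhs (G x)) _ _ xP).
have near_snd : \forall y \near (x, G x),
    frob_norm ((y : V * 'M[R]_n).2 - G x) <= r.
  apply: (@cvg_snd _ _ (nbhs x) (nbhs (G x)) _
    [set Z | frob_norm (Z - G x) <= r]).
  exact: near_frob_norm_le.
near=> y.
have y1 : (F x + (ip d (y.1 - x) - e / 2 * N (y.1 - x))%:E <= F y.1)%E.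
  by near: y; exact: (near_fst _ (Fx _ e2)).
have y2 : frob_norm (G y.1 - G x) <= L * N (y.1 - x).
  by near: y; exact: (near_fst _ GL).
have y3 : N (y.1 - x) <= r by near: y; exact: (near_fst _ (Ncont _ r0)).
have y4 : frob_norm (y.2 - G x) <= r by near: y.
set u := y - (x, G x); set nu := ip_norm ipG u.
have nu0 : 0 <= nu := ip_norm_ge0 ipG u.
have nu1 : N (y.1 - x) <= nu := le_ip_norm_prod1 ip0r ip_norm_gt0 u.
have nu2 : frob_norm (y.2 - G x) <= nu := le_ip_norm_prod2 ip0r ip_norm_gt0 u.
have nur : nu <= 2 * r.
  apply: (le_trans (ip_norm_prod_le ip0r ip_norm_gt0 u)).
  by rewrite /u /= -/N; lra.
have Qy : - (e / 2 * nu) <= Q (y.2 - G y.1).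
  have Wle : frob_norm (y.2 - G y.1) <= (1 + L) * nu.
    have -> : y.2 - G y.1 = (y.2 - G x) - (G y.1 - G x).
      by rewrite opprB addrA subrK.
    apply: le_trans (ler_frob_normB _ _) _.
    rewrite mulrDl mul1r lerD //; apply: (le_trans y2).
    by rewrite ler_wpM2l.
  have := Q_le (y.2 - G y.1); rewrite ler_norml => /andP[+ _].
  apply: le_trans; rewrite lerN2.
  apply: (@le_trans _ _ (M * nu * nu)).
    rewrite /M -!mulrA ler_wpM2l // mulrA -expr2 -exprMn ler_sqr //.
      by rewrite nnegrE frob_norm_ge0.
    by rewrite nnegrE mulr_ge0 // addr_ge0.
  by rewrite ler_wpM2r // (le_trans (ler_wpM2l M0 nur)) // mulrA (mulrC M).
rewrite /T /= subrr Q0 adde0 /ipG /prod_ip /= frob_ip0l addr0.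
apply: (@le_trans _ _ (F x + (ip d (y.1 - x) - e / 2 * N (y.1 - x))%:E
                       + (- (e / 2 * nu))%:E)%E); last first.
  by apply: leeD => //; rewrite lee_fin.
rewrite -addeA -EFinD leeD2l // lee_fin -/ipG -/u -/nu.
have := @ler_wpM2l _ _ (ltW e2) _ _ nu1; lra.
Unshelve. all: by end_near.
Qed.

(** If [g = gQ W - d.2] were nonzero, moving [w.2] by [- t *: g] would lower [T] relative to its
    linear minorant by [t |g|^2] up to a remainder of order [t^2], which is impossible for small
    [t > 0]. *)
Lemma frechet_subdiff_lift_snd (gQ : 'M[R]_n -> 'M[R]_n) (w : V * 'M[R]_n)
    (d : V * 'M[R]_n) :
  (forall W H, Q (W + H) = Q W + frob_ip (gQ W) H + Q H) ->
  frechet_subdiff ipG T w d -> d.2 = gQ (w.2 - G w.1).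
Proof.
move=> QD /frechetTP[wdom Tw].
set W := w.2 - G w.1; apply/esym/eqP; rewrite -subr_eq0; set g := _ - _.
apply/negPn/negP => gn0.
have g0 := frob_norm_gt0 gn0.
set c := frob_norm g in g0.
(* The tolerance [c / 2] uses up only half of the decrease [t * c ^ 2]. *)
have c2 : 0 < c / 2 by lra.
pose p (t : R) : V * 'M[R]_n := (w.1, w.2 - t *: g).
have pw2 : w.2 - t *: g @[t --> 0^'+] --> w.2.
  rewrite -[X in _ --> X]subr0 -(scale0r g).
  apply: cvgB; first exact: cvg_cst.
  apply: cvgZ; last exact: cvg_cst.
  exact: cvg_at_right_filter cvg_id.
have pw : p t @[t --> 0^'+] --> w.
  rewrite [X in _ --> X]surjective_pairing.
  by apply: (@cvg_pair _ _ _ _ (nbhs w.1) (nbhs w.2)) => //; exact: cvg_cst.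
have K1 : 0 < 4 * (K + 1) by have := K_ge0; lra.
near (0 : R)^'+ => t.
have t0 : 0 < t by near: t; exact: nbhs_right_gt.
(* This makes [K * t < 1 / 2], so the quadratic remainder is below the remaining half. *)
have tK : t < (4 * (K + 1))^-1.
  by near: t; apply: nbhs_right_lt; rewrite invr_gt0.
have : (T w + (ipG d (p t - w) - c / 2 * ip_norm ipG (p t - w))%:E
    <= T (p t))%E.
  by near: t; exact: (pw _ (Tw _ c2)).
have p1 : (p t - w).1 = 0 by rewrite /= subrr.
have p2 : (p t - w).2 = - (t *: g) by rewrite /= addrAC subrr sub0r.
have := ip_norm_prod_le ip0r ip_norm_gt0 (p t - w).
rewrite /ipG {2}/prod_ip p1 p2 ip0r (ip_norm0 ip0r) !add0r.
rewrite frob_normN frob_normZ gtr0_norm //.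
rewrite -/ipG -/c; set nu := ip_norm _ _ => nule.
have -> : T w = (F w.1 + (Q W)%:E)%E by [].
have -> : T (p t) = (F w.1 + (Q (W - t *: g))%:E)%E.
  by rewrite /T /W /= addrAC.
move: wdom; rewrite /effective_domain /T /=.
case: (F w.1) (FNy w.1) => [s| |] // _ _.
rewrite -!EFinD lee_fin QD !frob_ipNr !frob_ipZr => H.
have gg : frob_ip (gQ W) g - frob_ip d.2 g = c ^+ 2.
  by rewrite -frob_ipBl sqr_frob_norm.
have := Q_le (- (t *: g)); rewrite ler_norml => /andP[_].
rewrite frob_normN frob_normZ gtr0_norm // -/c => Qt.
have {}nule := ler_wpM2l (ltW c2) nule.
have {}H : t * (c ^+ 2 / 2) <= t * (K * t * c ^+ 2).
  have := congr1 ( *%R t) gg; rewrite mulrBr => gg'.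
  have -> : t * (K * t * c ^+ 2) = K * (t * c) ^+ 2 by ring.
  by move: nule; rewrite mulrCA mulrA => nule; lra.
move: H; rewrite ler_pM2l // => H.
have Kt : K * t < 1 / 2.
  move: tK; rewrite -[_^-1]mul1r ltr_pdivlMr // => tK.
  have := mulr_ge0 K_ge0 (ltW t0); lra.
have : 0 < c ^+ 2 by rewrite exprn_gt0.
nra.
Unshelve. all: by end_near.
Qed.

(** Along the curve [u |-> (u, G u + W)] through [w] the penalty is the constant [Q W], so the
    subgradient inequality for [T] becomes one for [F]. The vector [a] stands for the adjoint
    derivative of [G] applied to [d.2], with an error quadratic in the displacement. *)
Lemma frechet_subdiff_unlift (w d : V * 'M[R]_n) (a : V) (L C : R) :
  0 <= L -> 0 <= C ->
  (forall v, ip (d.1 + a) v = ip d.1 v + ip a v) ->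
  (forall e, 0 < e -> \forall u \near w.1, N (u - w.1) <= e) ->
  G u @[u --> w.1] --> G w.1 ->
  (\forall u \near w.1, frob_norm (G u - G w.1) <= L * N (u - w.1)) ->
  (forall u, ip a (u - w.1) - C * N (u - w.1) ^+ 2
     <= frob_ip d.2 (G u - G w.1)) ->
  frechet_subdiff ipG T w d -> frechet_subdiff ip F w.1 (d.1 + a).
Proof.
move=> L0 C0 ipD Ncont Gcont GL Gd.
move=> /frechetTP[wdom Tw].
have [s sE] : exists s, F w.1 = s%:E.
  move: wdom (FNy w.1); rewrite /effective_domain /T /=.
  by case: (F w.1) => [s| |] // _ _; exists s.
apply/(frechet_subdiffP ip0r ip_norm_gt0 _ _ FNy); split.
  by rewrite /effective_domain /= sE ltry.
move=> e e0.
pose W := w.2 - G w.1.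
pose k u : V * 'M[R]_n := (u, G u + W).
have kw : k u @[u --> w.1] --> w.
  have wE : w = (w.1, G w.1 + W) by rewrite /W addrC subrK -surjective_pairing.
  rewrite [X in _ --> X]wE.
  apply: (@cvg_pair _ _ _ _ (nbhs w.1) (nbhs (G w.1 + W))); first exact: cvg_id.
  exact: (cvgD Gcont (cvg_cst W)).
(* The Lipschitz bound makes the product distance at most [(1 + L) * N (u - w.1)], so [e'] costs
   [e / 2]; the radius [r] below makes the error [C * N (u - w.1) ^+ 2] cost the other [e / 2]. *)
pose e' := e / (2 * (1 + L)).
have e'0 : 0 < e' by rewrite divr_gt0 //; lra.
have e'L : e' * (1 + L) = e / 2 by rewrite /e'; field; lra.
pose r := e / (2 * (1 + C)).
have r0 : 0 < r by rewrite divr_gt0 //; lra.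
have rC : r * (1 + C) = e / 2 by rewrite /r; field; lra.
near=> u.
have u1 : N (u - w.1) <= r by near: u; exact: Ncont.
have u2 : frob_norm (G u - G w.1) <= L * N (u - w.1) by near: u.
have : (T w + (ipG d (k u - w) - e' * ip_norm ipG (k u - w))%:E <= T (k u))%E.
  by near: u; exact: (kw _ (Tw _ e'0)).
have k2 : (k u - w).2 = G u - G w.1.
  by rewrite /= /W -addrA [w.2 - _ - _]addrAC subrr sub0r.
have := ip_norm_prod_le ip0r ip_norm_gt0 (k u - w).
rewrite /ipG {2}/prod_ip k2 [(k u - w).1]/= -/ipG.
set nu := ip_norm _ _; rewrite -/N => nule.
have -> : T w = (F w.1 + (Q W)%:E)%E by [].
have -> : T (k u) = (F u + (Q W)%:E)%E by rewrite /T /= addrAC subrr add0r.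
rewrite sE.
case: (F u) (FNy u) => [s'| |] // _; last by move=> *; rewrite leey.
rewrite -!EFinD !lee_fin ipD.
have := Gd u.
have N0u : 0 <= N (u - w.1) := ip_norm_ge0 ip _.
have : e' * nu <= e' * ((1 + L) * N (u - w.1)).
  by rewrite ler_pM2l //; lra.
rewrite mulrA e'L.
have : C * N (u - w.1) ^+ 2 <= e / 2 * N (u - w.1).
  rewrite expr2 mulrA ler_wpM2r // -rC.
  by have := ler_wpM2l C0 u1; lra.
rewrite -/N; lra.
Unshelve. all: by end_near.
Qed.

End Lift.

(** * The penalty, the optimal [Z], and transfer of stationarity *)

Section Relaxation.
Context {R : realType} {n r q : nat}.
Context (A : {linear 'M[R]_n -> 'cV[R]_q}) (b : 'cV[R]_q) (lambda : R).
Context (Psi Phi : 'M[R]_(n, r) -> \bar R) (alpha beta : R).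
Hypothesis Psi_proper : proper_function Psi.
Hypothesis Phi_proper : proper_function Phi.
Hypothesis AAadj : forall y : 'cV[R]_q, A (adjoint A y) = y.
Hypothesis alpha_neq0 : alpha != 0.
Hypothesis beta_neq0 : beta != 0.
Hypothesis inv_alpha_beta : alpha^-1 + beta^-1 = 1.

Let c := beta / (alpha + beta).

(** The hypothesis on the reciprocals says [alpha + beta = alpha * beta]; hence the denominator of
    [c] is nonzero and [c = alpha^-1]. *)
Let alpha_c : alpha * c = 1.
Proof.
have ab : alpha + beta = alpha * beta.
  rewrite -[RHS]mulr1 -inv_alpha_beta; field.
  by rewrite alpha_neq0 beta_neq0.
by rewrite /c ab; field; rewrite alpha_neq0 beta_neq0.
Qed.

Let beta_1c : beta * (1 - c) = 1.
Proof.
have cE : c = alpha^-1 by apply: (mulfI alpha_neq0); rewrite alpha_c divff.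
have -> : 1 - c = beta^-1 by rewrite cE -inv_alpha_beta addrAC subrr add0r.
by rewrite divff.
Qed.

(** The linear part of [best_Z] in the product [X Y^T]. It is self-adjoint, and it is also [alpha]
    times the inverse of [Z_penalty_grad]. *)
Definition shrink (P : 'M[R]_n) : 'M[R]_n := P - c *: adjoint A (A P).

Lemma shrink_is_linear : linear shrink.
Proof.
move=> k P P'; rewrite /shrink !linearP /= !scalerDr scalerN !scalerA.
by rewrite addrACA.
Qed.

HB.instance Definition _ :=
  GRing.isLinear.Build R 'M[R]_n 'M[R]_n *:%R shrink shrink_is_linear.

Lemma frob_ip_shrink (E P : 'M[R]_n) :
  frob_ip E (shrink P) = frob_ip (shrink E) P.
Proof.
rewrite /shrink frob_ipBr frob_ipBl frob_ipZr frob_ipZl -adjointP.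
by rewrite (frob_ipC (adjoint A (A E))) -adjointP (frob_ipC (A P)).
Qed.

Lemma frob_norm_shrink_le (P : 'M[R]_n) :
  frob_norm (shrink P) <= (1 + `|c|) * frob_norm P.
Proof.
apply: le_trans (ler_frob_normB _ _) _.
by rewrite frob_normZ mulrDl mul1r lerD2l ler_wpM2l // frob_norm_adjoint_comp.
Qed.

(* For fixed [X], [Y], the unique critical point of [Theta] in [Z]. *)
Definition best_Z (x : 'M[R]_(n, r) * 'M[R]_(n, r)) : 'M[R]_n :=
  shrink (x.1 *m x.2^T) + c *: adjoint A b.

Definition Z_penalty (W : 'M[R]_n) : R :=
  alpha / 2 * frob_norm W ^+ 2 + beta / 2 * frob_norm (A W) ^+ 2.

Definition Z_penalty_grad (W : 'M[R]_n) : 'M[R]_n :=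
  alpha *: W + beta *: adjoint A (A W).

Let F := F_obj A b Psi Phi lambda.
Let Theta := Theta_obj A b Psi Phi alpha beta lambda.

(** With [rho = A P - b], both residuals are combinations of [rho] and [W]: [P - Z = c A^* rho - W]
    and [A Z - b = (1 - c) rho + A W]. The cross terms carry the weights [alpha * c] and
    [beta * (1 - c)] with opposite signs; both weights are 1, so they cancel and [rho] keeps the
    coefficient 1/2. *)
Lemma Theta_objE w :
  Theta w = (F w.1 + (Z_penalty (w.2 - best_Z w.1))%:E)%E.
Proof.
case: w => -[X Y] Z; rewrite /Theta /F /Theta_obj /F_obj /=.
set P := X *m Y^T; set W := Z - best_Z (X, Y); set rho := A P - b.
have PZ : P - Z = c *: adjoint A rho - W.
  rewrite /W /best_Z /shrink /= -/P /rho linearB /= scalerBr.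
  by apply/matrixP => i j; rewrite !mxE; ring.
have AZ : A Z - b = (1 - c) *: rho + A W.
  rewrite /W /best_Z /shrink /= -/P !(linearB A) (linearD A) !(linearB A).
  rewrite !(linearZ_LR A) /= !AAadj.
  by rewrite /rho; apply/matrixP => i j; rewrite !mxE; ring.
clearbody W rho.
have PZ2 : frob_norm (P - Z) ^+ 2 =
    c ^+ 2 * frob_norm rho ^+ 2 - 2 * c * frob_ip (A W) rho + frob_norm W ^+ 2.
  rewrite PZ !sqr_frob_norm frob_ipBl !frob_ipBr !(frob_ipZl, frob_ipZr).
  by rewrite -!adjointP AAadj (frob_ipC (adjoint A rho)) -adjointP; ring.
have AZ2 : frob_norm (A Z - b) ^+ 2 = (1 - c) ^+ 2 * frob_norm rho ^+ 2
    + 2 * (1 - c) * frob_ip (A W) rho + frob_norm (A W) ^+ 2.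
  rewrite AZ !sqr_frob_norm frob_ipDl !frob_ipDr !(frob_ipZl, frob_ipZr).
  by rewrite (frob_ipC rho (A W)); ring.
rewrite PZ2 AZ2 /Z_penalty; move: (frob_norm rho) (frob_ip _ rho) => x y.
(* If [Psi X] or [Phi Y] is infinite, both sides have the same infinite value; only the real
   identity remains. *)
case: (Psi X) => [s| |]; case: (Phi Y) => [t| |] //=; congr EFin.
set l := lambda / 2 * _; set a := frob_norm W ^+ 2.
set d := frob_norm (A W) ^+ 2.
have e1 : alpha / 2 * (c ^+ 2 * x ^+ 2 - 2 * c * y + a) =
    (alpha * c) * (c / 2 * x ^+ 2 - y) + alpha / 2 * a by field.
have e2 : beta / 2 * ((1 - c) ^+ 2 * x ^+ 2 + 2 * (1 - c) * y + d) =
    (beta * (1 - c)) * ((1 - c) / 2 * x ^+ 2 + y) + beta / 2 * d by field.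
by rewrite e1 e2 alpha_c beta_1c; field.
Qed.

Lemma Z_penalty_le W :
  `|Z_penalty W| <= (`|alpha| / 2 + `|beta| / 2) * frob_norm W ^+ 2.
Proof.
have AW : frob_norm (A W) ^+ 2 <= frob_norm W ^+ 2.
  rewrite sqr_frob_norm adjointP expr2; apply: le_trans (ler_norm _) _.
  apply: le_trans (frob_ip_le _ _) _.
  by rewrite ler_wpM2l ?frob_norm_ge0 ?frob_norm_adjoint_comp.
have half_le k (x y : R) : 0 <= x -> x <= y -> `|k / 2 * x| <= `|k| / 2 * y.
  move=> x0 xy; rewrite normrM (ger0_norm x0) normrM (@ger0_norm _ 2^-1) //.
  by rewrite ler_wpM2l.
apply: le_trans (ler_normD _ _) _; rewrite mulrDl.
by rewrite lerD // half_le ?sqr_ge0.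
Qed.

Lemma Z_penaltyD W H :
  Z_penalty (W + H) = Z_penalty W + frob_ip (Z_penalty_grad W) H + Z_penalty H.
Proof.
rewrite /Z_penalty /Z_penalty_grad linearD !sqr_frob_norm !frob_ipDl !frob_ipDr.
rewrite !frob_ipZl (frob_ipC (adjoint A _)) -adjointP (frob_ipC H W).
by rewrite (frob_ipC (A H) (A W)); field.
Qed.

(** Nondegeneracy of the penalty: as [A^* A] is idempotent, [shrink] subtracts
    [c * (alpha + beta) = beta] times [A^* A W] and leaves [alpha *: W]. *)
Lemma Z_penalty_gradK W : alpha^-1 *: shrink (Z_penalty_grad W) = W.
Proof.
have cab : c * (alpha + beta) = beta.
  by move: alpha_c beta_1c; lra.
rewrite /shrink /Z_penalty_grad (linearD A) !(linearZ_LR A) /= AAadj -scalerDl.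
rewrite (linearZ_LR (adjoint A)) /= (scalerA c) cab addrK scalerA.
by rewrite mulVf ?scale1r.
Qed.


Let ip2_0r v : @ip2 R n r v 0 = 0.
Proof. by rewrite /ip2 (ip_prod0r frob_ip0r). Qed.

Let ip2_norm_gt0 v : v != 0 -> 0 < ip_norm (@ip2 R n r) v.
Proof. exact: (ip_norm_prod_gt0 frob_ip0r frob_norm_gt0). Qed.

Let F_NyE x : (-oo < F x)%E.
Proof.
case: x => X Y; rewrite /F /F_obj.
case: (Psi X) (Psi_proper.1 X) => [s| |] // _;
  by case: (Phi Y) (Phi_proper.1 Y) => [t| |] // _; rewrite ?ltNyr.
Qed.

Let near_ip2_norm_le (x : 'M[R]_(n, r) * 'M[R]_(n, r)) (e : R) : 0 < e ->
  \forall u \near x, ip_norm (@ip2 R n r) (u - x) <= e.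
Proof.
move=> e0; have e2 : 0 < e / 2 by lra.
near=> u.
have u1 : frob_norm (u.1 - x.1) <= e / 2.
  near: u; apply: (@cvg_fst _ _ (nbhs x.1) (nbhs x.2) _
    [set X | frob_norm (X - x.1) <= e / 2]).
  exact: near_frob_norm_le.
have u2 : frob_norm (u.2 - x.2) <= e / 2.
  near: u; apply: (@cvg_snd _ _ (nbhs x.1) (nbhs x.2) _
    [set X | frob_norm (X - x.2) <= e / 2]).
  exact: near_frob_norm_le.
apply: (le_trans (ip_norm_prod_le frob_ip0r frob_norm_gt0 _)).
by rewrite [e]splitr lerD.
Unshelve. all: by end_near.
Qed.

Lemma best_Z_cvg (T : Type) (H : set_system T) {FH : Filter H}
    (x_ : T -> 'M[R]_(n, r) * 'M[R]_(n, r)) x :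
  x_ @ H --> x -> best_Z (x_ k) @[k --> H] --> best_Z x.
Proof.
move=> x_x; apply: cvgD; last exact: cvg_cst.
have xyx : (x_ k).1 *m (x_ k).2^T @[k --> H] --> x.1 *m x.2^T.
  apply: cvg_mulmx; first exact: cvg_comp x_x cvg_fst.
  by apply: cvg_trmx; exact: cvg_comp x_x cvg_snd.
exact: (cvg_comp _ _ xyx (@linear_mx_continuous _ _ _ _ _ shrink _)).
Qed.

(** The derivative of [X Y^T] at [x] plus its bilinear remainder. *)
Let mulmx_trmxB (x u : 'M[R]_(n, r) * 'M[R]_(n, r)) :
  u.1 *m u.2^T - x.1 *m x.2^T =
  x.1 *m (u.2 - x.2)^T + (u.1 - x.1) *m x.2^T + (u.1 - x.1) *m (u.2 - x.2)^T.
Proof.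
have -> : (u.2 - x.2)^T = u.2^T - x.2^T by rewrite linearB.
rewrite !mulmxBr !mulmxBl.
by apply/matrixP => i j; rewrite !mxE; ring.
Qed.

Let best_ZB x u : best_Z u - best_Z x = shrink (u.1 *m u.2^T - x.1 *m x.2^T).
Proof. by rewrite /best_Z [in RHS]linearB opprD addrACA subrr addr0. Qed.

Lemma best_Z_lipschitz x : exists2 L, 0 <= L &
  \forall u \near x, frob_norm (best_Z u - best_Z x)
    <= L * ip_norm (@ip2 R n r) (u - x).
Proof.
(* The factor [1 + |c|] bounds [shrink]. The norms of [x.1] and [x.2] bound the two linear terms,
   and the 1 bounds the remainder on the unit neighbourhood. *)
pose L := (1 + `|c|) * (frob_norm x.1 + frob_norm x.2 + 1).
have L0 : 0 <= L.
  by rewrite mulr_ge0 ?addr_ge0 ?frob_norm_ge0 ?ler01.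
exists L => //; near=> u.
have u1 : ip_norm (@ip2 R n r) (u - x) <= 1.
  by near: u; exact: near_ip2_norm_le.
have := le_ip_norm_prod1 frob_ip0r frob_norm_gt0 (u - x).
have := le_ip_norm_prod2 frob_ip0r frob_norm_gt0 (u - x).
rewrite -/(ip2 _ _) /=; set nu := ip_norm _ _ in u1 * => H2 H1.
have nu0 : 0 <= nu := ip_norm_ge0 _ _.
rewrite best_ZB; apply: (le_trans (frob_norm_shrink_le _)).
rewrite /L -mulrA ler_wpM2l ?addr_ge0 // mulmx_trmxB.
rewrite !mulrDl; apply: (le_trans (ler_frob_normD _ _)); apply: lerD.
  apply: (le_trans (ler_frob_normD _ _)); apply: lerD.
    apply: (le_trans (frob_norm_mulmx_trmx _ _)).
    by rewrite ler_wpM2l ?frob_norm_ge0.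
  apply: (le_trans (frob_norm_mulmx_trmx _ _)).
  by rewrite mulrC ler_wpM2l ?frob_norm_ge0.
apply: (le_trans (frob_norm_mulmx_trmx _ _)).
by rewrite ler_pM ?frob_norm_ge0 // (le_trans H1).
Unshelve. all: by end_near.
Qed.

(* The adjoint of the derivative of [best_Z] at [x]. *)
Definition best_Z_dadj (x : 'M[R]_(n, r) * 'M[R]_(n, r)) (E : 'M[R]_n) :
    'M[R]_(n, r) * 'M[R]_(n, r) :=
  (shrink E *m x.2, (shrink E)^T *m x.1).

(** The linear terms agree exactly by cyclicity of the trace; the remainder [<S, H K^T>] is at least
    [- |S| |H| |K|], and [|H|] and [|K|] are at most the norm of [u - x]. *)
Lemma best_Z_expansion x u E :
  ip2 (best_Z_dadj x E) (u - x)
    - frob_norm (shrink E) * ip_norm (@ip2 R n r) (u - x) ^+ 2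
  <= frob_ip E (best_Z u - best_Z x).
Proof.
rewrite best_ZB frob_ip_shrink mulmx_trmxB frob_ipDr.
set S := shrink E; set H := u.1 - x.1; set K := u.2 - x.2.
have -> : ip2 (best_Z_dadj x E) (u - x) =
    frob_ip S (x.1 *m K^T + H *m x.2^T).
  rewrite frob_ipDr [RHS]addrC /ip2 /prod_ip /= -/H -/K -/S; congr (_ + _).
    by rewrite /frob_ip trmx_mul mulmxA [RHS]mxtrace_mulC mulmxA.
  rewrite /frob_ip trmx_mul trmxK -[RHS]mxtrace_tr !trmx_mul !trmxK.
  by rewrite -[in RHS]mulmxA [RHS]mxtrace_mulC.
rewrite lerD2l.
have := le_ip_norm_prod1 frob_ip0r frob_norm_gt0 (u - x).
have := le_ip_norm_prod2 frob_ip0r frob_norm_gt0 (u - x).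
rewrite -/(ip2 _ _) /= -/H -/K; set nu := ip_norm _ _ => H2 H1.
have := frob_ip_le S (H *m K^T); rewrite ler_norml => /andP[+ _].
apply: le_trans; rewrite lerN2 ler_wpM2l ?frob_norm_ge0 //.
apply: (le_trans (frob_norm_mulmx_trmx _ _)).
by rewrite expr2 ler_pM ?frob_norm_ge0.
Qed.

Let TE : Theta = fun w => (F w.1 + (Z_penalty (w.2 - best_Z w.1))%:E)%E.
Proof. by apply/funext => w; exact: Theta_objE. Qed.

Let pen0 : Z_penalty 0 = 0.
Proof. by rewrite /Z_penalty linear0 !frob_norm0 expr0n !mulr0 addr0. Qed.

(** The approximating sequence is lifted to the graph of [best_Z], where the penalty vanishes and
    [Theta] takes the values of [F]; subgradients are padded with 0. *)
Lemma stationary_best_Z x :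
  stationary_point (@ip2 R n r) F x ->
  stationary_point (@ip3 R n r) Theta (x, best_Z x).
Proof.
have TxE u : Theta (u, best_Z u) = F u by rewrite TE /= subrr pen0 adde0.
move=> [xdom [x_ [D_ [x_x Fx D0 Dx]]]].
split; first by rewrite /effective_domain /mkset TxE.
exists (fun k => (x_ k, best_Z (x_ k))), (fun k => (D_ k, 0)); split.
- apply: (@cvg_pair _ _ _ _ (nbhs x) (nbhs (best_Z x))) => //.
  exact: best_Z_cvg.
- rewrite TxE (_ : _ \o _ = F \o x_) //.
  by apply/funext => k; rewrite /comp TxE.
- by apply: (@cvg_pair _ _ _ _ (nbhs 0) (nbhs 0)) => //; exact: cvg_cst.
- move=> k; rewrite TE; have [L L0 lip] := best_Z_lipschitz (x_ k).
  apply: (frechet_subdiff_lift ip2_0r ip2_norm_gt0 F_NyE _ Z_penalty_le L0 _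
    lip (Dx k)).
    by rewrite addr_ge0 // divr_ge0.
  by move=> e; exact: near_ip2_norm_le.
Qed.

(** [Z] is arbitrary here; the proof finds that it must be [best_Z x], as the residuals [W_ k] tend
    both to 0 and to [Z - best_Z x]. *)
Lemma stationary_fst x Z :
  stationary_point (@ip3 R n r) Theta (x, Z) ->
  stationary_point (@ip2 R n r) F x.
Proof.
have K0 : 0 <= `|alpha| / 2 + `|beta| / 2 by rewrite addr_ge0 // divr_ge0.
move=> [xdom [w_ [D_ [w_w Tw D0 Dw]]]].
pose W_ k := (w_ k).2 - best_Z (w_ k).1.
have x_x : (w_ k).1 @[k --> \oo] --> x by exact: cvg_comp w_w cvg_fst.
have D1 : (D_ k).1 @[k --> \oo] --> (0 : 'M[R]_(n, r) * 'M[R]_(n, r)).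
  by exact: cvg_comp D0 cvg_fst.
have D2 : (D_ k).2 @[k --> \oo] --> (0 : 'M[R]_n) by exact: cvg_comp D0 cvg_snd.
have gradW k : (D_ k).2 = Z_penalty_grad (W_ k).
  have := Dw k; rewrite TE.
  exact: (frechet_subdiff_lift_snd ip2_0r ip2_norm_gt0 F_NyE K0 Z_penalty_le
    Z_penaltyD).
have J0 : shrink (D_ k).2 @[k --> \oo] --> (0 : 'M[R]_n).
  rewrite -[X in _ --> X](linear0 shrink).
  exact: (cvg_comp _ _ D2 (@linear_mx_continuous _ _ _ _ _ shrink _)).
(* Inverting the gradient expresses [W_ k] through the vanishing [Z]-component of the
   subgradient. *)
have W0 : W_ @ \oo --> (0 : 'M[R]_n).
  rewrite (_ : W_ = fun k => alpha^-1 *: shrink (D_ k).2); last first.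
    by apply/funext => k; rewrite gradW Z_penalty_gradK.
  by rewrite -(scaler0 _ alpha^-1); apply: cvgZ => //; exact: cvg_cst.
have Q0 : Z_penalty (W_ k) @[k --> \oo] --> (0 : R).
  rewrite -pen0 /Z_penalty; apply: cvgD; (apply: cvgM; first exact: cvg_cst).
    by apply: cvgM; exact: cvg_frob_norm.
  have AW : A (W_ k) @[k --> \oo] --> A 0.
    exact: (cvg_comp _ _ W0 (@linear_mx_continuous _ _ _ _ _ A _)).
  by apply: cvgM; exact: cvg_frob_norm.
have ZE : Z - best_Z x = 0.
  have WZ : W_ @ \oo --> Z - best_Z x.
    by apply: cvgB; [exact: cvg_comp w_w cvg_snd|exact: best_Z_cvg].
  exact: (cvg_unique (@norm_hausdorff _ _) WZ W0).
have TxE : Theta (x, Z) = F x by rewrite TE /= ZE pen0 adde0.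
split; first by rewrite /effective_domain /mkset -TxE.
exists (fun k => (w_ k).1), (fun k => (D_ k).1 + best_Z_dadj (w_ k).1 (D_ k).2).
split => //.
(* The penalty is finite and tends to 0, so convergence of the [Theta] values passes to [F] by
   subtraction. *)
- have -> : F \o (fun k => (w_ k).1) =
      fun k => (Theta (w_ k) - (Z_penalty (W_ k))%:E)%E.
    by apply/funext => k; rewrite TE /= -addeA -EFinB subrr adde0.
  rewrite -TxE -[X in _ --> X]sube0; apply: cvgeB => //.
    by rewrite fin_num_adde_defl // oppe0.
  by apply: cvg_EFin => //; exact: nearW.
(* The correction tends to 0: each component is a product of a vanishing factor and a convergent
   one. *)
- rewrite -[X in _ --> X]addr0; apply: cvgD => //.
  apply: (@cvg_pair _ _ _ _ (nbhs 0) (nbhs 0)).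
    rewrite -(mul0mx _ x.2); apply: cvg_mulmx => //.
    exact: cvg_comp x_x cvg_snd.
  rewrite -(mul0mx _ x.1) -trmx0; apply: cvg_mulmx; first exact: cvg_trmx.
  exact: cvg_comp x_x cvg_fst.
- move=> k; have [L L0 lip] := best_Z_lipschitz (w_ k).1.
  have := Dw k; rewrite TE.
  apply: (frechet_subdiff_unlift ip2_0r ip2_norm_gt0 F_NyE L0
    (frob_norm_ge0 _)).
  + by move=> v; rewrite /ip2 /prod_ip /= !frob_ipDl addrACA.
  + by move=> e; exact: near_ip2_norm_le.
  + exact: best_Z_cvg cvg_id.
  + exact: lip.
  + by move=> u; exact: best_Z_expansion.
Qed.

End Relaxation.

Theorem theorem3p3 (R : realType) (n r q : nat)
    (hr : (r <= n)%N) (hq : (q <= n ^ 2)%N)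
    (A : {linear 'M[R]_n -> 'cV[R]_q}) (b : 'cV[R]_q)
    (lambda : R) (hlambda : 0 <= lambda)
    (Psi Phi : 'M[R]_(n, r) -> \bar R)
    (Psi_proper : proper_function Psi) (Psi_closed : lower_semicontinuous Psi)
    (Phi_proper : proper_function Phi) (Phi_closed : lower_semicontinuous Phi)
    (hA : forall y : 'cV[R]_q, A (adjoint A y) = y)
    (alpha beta : R) (halpha : alpha != 0) (hbeta : beta != 0)
    (hab : alpha^-1 + beta^-1 = 1) :
  (forall (X Y : 'M[R]_(n, r)) (Z : 'M[R]_n),
     stationary_point (@ip3 R n r) (Theta_obj A b Psi Phi alpha beta lambda)
       (X, Y, Z) ->
     stationary_point (@ip2 R n r) (F_obj A b Psi Phi lambda) (X, Y)) /\
  (forall X Y : 'M[R]_(n, r),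
     stationary_point (@ip2 R n r) (F_obj A b Psi Phi lambda) (X, Y) ->
     let P := X *m Y^T in
     let Z := (P - (beta / (alpha + beta)) *: adjoint A (A P))
              + (beta / (alpha + beta)) *: adjoint A b in
     stationary_point (@ip3 R n r) (Theta_obj A b Psi Phi alpha beta lambda)
       (X, Y, Z)).
Proof.
split=> [X Y Z|X Y FXY P Z]; first exact: stationary_fst.
(* The local [Z] is convertible to [best_Z (X, Y)]. *)
exact: (stationary_best_Z Psi_proper Phi_proper hA halpha hbeta hab FXY).
Qed.
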